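(* There exist a finitely generated, residually finite group $G$ and two filtrations $(N_i)$ and $(M_i)$ of $G$ such that $N_i\le M_i$ for all $i$ (so that there are canonical surjections $G/N_i\twoheadrightarrow G/M_i$), the indices $[M_i:N_i]$ are bounded uniformly in $i$, and the box spaces $\Box_{(N_i)}G$ and $\Box_{(M_i)}G$ are not coarsely equivalent.
   Context: Filtration: for a residually finite, finitely generated group $G$, a filtration of $G$ is a sequence $(N_i)_{i\in\mathbb{N}}$ of nested ($N_{i+1}\subseteq N_i$), normal, finite index subgroups of $G$ with $\bigcap_i N_i=\{e\}$. Box space: fix a finite generating set $S$ of $G$. The box space $\Box_{(N_i)}G$ is the disjoint union $\bigsqcup_i G/N_i$, where each component $G/N_i$ carries the Cayley graph metric with respect to the image of $S$, and the distance between any two distinct components (i.e. between points of them) is the sum of their diameters. Changing the finite generating set gives a coarsely equivalent space. Coarse equivalence: a map $\varphi:X\to Y$ between metric spaces is a coarse embedding if there are proper functions $\rho_\pm:\mathbb{R}_+\to\mathbb{R}_+$ with $\rho_-(d_X(a,b))\le d_Y(\varphi(a),\varphi(b))\le\rho_+(d_X(a,b))$ for all $a,b\in X$. It is a coarse equivalence if moreover there is $C>0$ such that every $y\in Y$ is at distance at most $C$ from $\varphi(X)$. $X$ and $Y$ are coarsely equivalent if a coarse equivalence $X\to Y$ exists. *)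

(* Defs.v *)
From HB Require Import structures.
From mathcomp Require Import all_boot all_order all_algebra.
From mathcomp Require Import all_classical all_reals.
From mathcomp Require Import topology normedtype.

Set Implicit Arguments.
Unset Strict Implicit.
Unset Printing Implicit Defensive.

Import Order.TTheory GRing.Theory Num.Theory.
Import numFieldNormedType.Exports.

Local Open Scope classical_set_scope.
Local Open Scope ring_scope.

Section Groups.
Variable G : groupType.
Implicit Types (S H K N : set G) (F : nat -> set G).

Definition is_subgroup H : Prop := group_closed [in H].

Definition is_normal H : Prop :=
  is_subgroup H /\ forall x g : G, H x -> H (x ^ g)%g.

Definition left_coset (g : G) H : set G := [set (g * h)%g | h in H].

Definition cosets K H : set (set G) := [set left_coset g H | g in K].

Definition finite_index H : Prop := finite_set (cosets setT H).

(* [K : H] <= n, for a subgroup H of K *)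
Definition index_le K H (n : nat) : Prop := (cosets K H #<= `I_n)%card.

Definition generates S : Prop := smallest is_subgroup S = setT.

Definition finitely_generated : Prop :=
  exists2 S : set G, finite_set S & generates S.

Definition residually_finite : Prop :=
  forall g : G, g <> 1%g ->
    exists N : set G, [/\ is_normal N, finite_index N & ~ N g].

Definition is_filtration F : Prop :=
  [/\ forall i, F i.+1 `<=` F i,
      forall i, is_normal (F i),
      forall i, finite_index (F i)
    & \bigcap_i F i = [set 1%g]].

Definition quotient N : Type := cosets setT N.

(* Edges are oriented from gN to gsN; walks below ignore the orientation. *)
Definition cayley_edge S N (x y : quotient N) : Prop :=
  exists g s : G,
    [/\ S s, val x = left_coset g N & val y = left_coset (g * s)%g N].

Definition box F : Type := {i : nat & quotient (F i)}.

End Groups.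

Definition walk (T : Type) (e : T -> T -> Prop) (n : nat) (x y : T) : Prop :=
  exists p : nat -> T,
    [/\ p 0%N = x, p n = y
      & forall k, (k < n)%N -> e (p k) (p k.+1) \/ e (p k.+1) (p k)].

Section BoxMetric.
Variables (R : realType) (G : groupType) (S : set G).

(* The infimum is a minimum: if S generates G, the set is nonempty. *)
Definition cayley_dist (N : set G) (x y : quotient N) : R :=
  inf [set n%:R | n in [set n | walk (cayley_edge S (N:=N)) n x y]].

Definition cayley_diam (N : set G) : R :=
  sup [set d | exists x y : quotient N, d = cayley_dist x y].

(* When the tags agree, tagged_as x y is y transported to the component
   of x.  Two distinct one-point components are at distance 0. *)
Definition box_dist (N : nat -> set G) (x y : box N) : R :=
  if tag x == tag y then cayley_dist (tagged x) (tagged_as x y)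
  else cayley_diam (N (tag x)) + cayley_diam (N (tag y)).

End BoxMetric.

Arguments cayley_dist R [G] S [N] x y.
Arguments cayley_diam R [G] S N.
Arguments box_dist R [G] S N x y.

Section Coarse.
Variable R : realType.

(* A proper function from [0, +oo[ to itself: preimages of bounded sets are
   bounded.  Values at negative arguments are irrelevant. *)
Definition proper_control (rho : R -> R) : Prop :=
  (forall t, 0 <= t -> 0 <= rho t) /\
  forall B : set R, bounded_set B ->
    bounded_set ([set t | 0 <= t] `&` rho @^-1` B).

Variables (X Y : Type) (dX : X -> X -> R) (dY : Y -> Y -> R).

Definition coarse_embedding (phi : X -> Y) : Prop :=
  exists rho_minus rho_plus : R -> R,
    [/\ proper_control rho_minus, proper_control rho_plus
      & forall a b, rho_minus (dX a b) <= dY (phi a) (phi b)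
                    /\ dY (phi a) (phi b) <= rho_plus (dX a b)].

Definition coarse_equivalence (phi : X -> Y) : Prop :=
  coarse_embedding phi /\
  exists2 C : R, 0 < C & forall y, exists x, dY y (phi x) <= C.

Definition coarsely_equivalent : Prop :=
  exists phi : X -> Y, coarse_equivalence phi.

End Coarse.

(* Main.v *)
(* G is the free group generated by the Sanov matrices A = [1 2; 0 1] and
   B = [1 0; 2 1], with N_i and M_i the principal congruence subgroups of
   levels 2^(2i+2) and 2^(2i+1).  A coarse equivalence of the box spaces
   matches, with uniform constants, arbitrarily large components G/N_i of one
   with large components G/M_j of the other.  In the first cohomology
   of Cayley graphs of the free group (1-cochains modulo coboundaries), whose
   dimension is #vertices + 1 by Euler characteristic, a 1-cochain is pulled
   back along a coarse map by summing it over short paths; as the girth tends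
   to infinity, short paths with the same end points have the same sum, so
   that coarse inverses induce inverse maps.  Hence |G/N_i| = |G/M_j|, but
   the orders of the quotients of G by the congruence subgroups of level 2^n
   are pairwise distinct (for n > 0). *)
Require Import Defs.
From HB Require Import structures.
From mathcomp Require Import all_boot all_order all_algebra ring zify.
From mathcomp Require Import all_classical all_reals.
From mathcomp Require Import topology normedtype.

Set Implicit Arguments.
Unset Strict Implicit.
Unset Printing Implicit Defensive.

Import Order.TTheory GRing.Theory Num.Theory.
Import numFieldNormedType.Exports.

Local Open Scope classical_set_scope.
Local Open Scope ring_scope.

(** * Cochains on graphs with labelled edges *)

(* [(s, e)] stands for the generator of index [s], inverted when [e] holds. *)
Definition letter : Type := bool * bool.
Definition inv_letter (l : letter) : letter := (l.1, ~~ l.2).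
Definition inv_word (w : seq letter) := rev (map inv_letter w).

Lemma inv_word_cons l w : inv_word (l :: w) = rcons (inv_word w) (inv_letter l).
Proof. by rewrite /inv_word /= rev_cons. Qed.

Lemma size_inv_word w : size (inv_word w) = size w.
Proof. by rewrite size_rev size_map. Qed.

Lemma inv_letterK : involutive inv_letter.
Proof. by case=> s e; rewrite /inv_letter /= negbK. Qed.

Section PathSums.
Variables (V : zmodType) (X : Type) (act : X -> letter -> X).
Hypothesis actK : forall x l, act (act x l) (inv_letter l) = x.
Implicit Types (x : X) (l : letter) (w : seq letter) (z : X * bool -> V).

Definition end_point x w := foldl act x w.

(** The pair [(x, s)] encodes the edge from [x] to [act x (s, false)]. An inverted letter crosses an
    edge backwards: the edge is then indexed by the end point of the step and counts negatively. *)
Definition step_sum z x l := if l.2 then - z (act x l, l.1) else z (x, l.1).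

Fixpoint path_sum z x w : V :=
  if w is l :: w' then step_sum z x l + path_sum z (act x l) w' else 0.

Definition coboundary (f : X -> V) (e : X * bool) : V :=
  f (act e.1 (e.2, false)) - f e.1.

Lemma end_point_cat x w1 w2 :
  end_point x (w1 ++ w2) = end_point (end_point x w1) w2.
Proof. exact: foldl_cat. Qed.

Lemma end_point_inv x w : end_point (end_point x w) (inv_word w) = x.
Proof.
elim: w x => [|l w IH] x //=.
by rewrite inv_word_cons -cats1 end_point_cat /= IH actK.
Qed.

Lemma path_sum_cat z x w1 w2 :
  path_sum z x (w1 ++ w2) = path_sum z x w1 + path_sum z (end_point x w1) w2.
Proof. by elim: w1 x => [|l w IH] x /=; rewrite ?add0r // IH addrA. Qed.

Lemma step_sum_inv z x l : step_sum z (act x l) (inv_letter l) = - step_sum z x l.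
Proof.
case: l => s [] /=; rewrite /step_sum ?opprK //=.
by rewrite (actK x (s, false)).
Qed.

Lemma path_sum_inv z x w :
  path_sum z (end_point x w) (inv_word w) = - path_sum z x w.
Proof.
elim: w x => [|l w IH] x /=; first by rewrite oppr0.
rewrite inv_word_cons -cats1 path_sum_cat IH end_point_inv /= addr0.
by rewrite step_sum_inv opprD addrC.
Qed.

Lemma path_sum_coboundary f x w :
  path_sum (coboundary f) x w = f (end_point x w) - f x.
Proof.
elim: w x => [|l w IH] x /=; first by rewrite subrr.
rewrite IH addrC; suff -> : step_sum (coboundary f) x l = f (act x l) - f x.
  by rewrite addrA subrK.
case: l => s [] //=; rewrite /step_sum /coboundary /=.
by rewrite (actK x (s, true)) opprB.
Qed.

(* Girth larger than [2 * n], expressed through 1-cochains: up to this scale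
   path sums only depend on the end points. *)
Definition locally_free n := forall z x w1 w2,
  (size w1 <= n)%N -> (size w2 <= n)%N -> end_point x w1 = end_point x w2 ->
  path_sum z x w1 = path_sum z x w2.

Definition word_connected := forall x y, exists w, y = end_point x w.

End PathSums.

Definition word_near (X : Type) (act : X -> letter -> X) n x y :=
  exists2 w, (size w <= n)%N & y = end_point act x w.

(** * Pullback of 1-cochains along coarse maps *)

Section Pullback.
Variables (V : zmodType) (X Y : Type).
Variables (aX : X -> letter -> X) (aY : Y -> letter -> Y).
Hypothesis aXK : forall x l, aX (aX x l) (inv_letter l) = x.
Hypothesis aYK : forall x l, aY (aY x l) (inv_letter l) = x.
Variables (phi : X -> Y) (u : X * bool -> seq letter).
Hypothesis uP : forall x s,
  phi (aX x (s, false)) = end_point aY (phi x) (u (x, s)).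

Definition pullback (z : Y * bool -> V) (e : X * bool) : V :=
  path_sum aY z (phi e.1) (u e).

(** Concatenate the words that [u] assigns to the edges along [w], taking the inverse word for an
    edge crossed backwards. *)
Lemma path_sum_pullback k (uk : forall e, (size (u e) <= k)%N) x w :
  exists w', [/\ end_point aY (phi x) w' = phi (end_point aX x w),
    (size w' <= size w * k)%N &
    forall z, path_sum aY z (phi x) w' = path_sum aX (pullback z) x w].
Proof.
elim: w x => [|l w IH] x; first by exists [::].
have [w' [e1 s1 p1]] := IH (aX x l).
suff [v [e2 s2 p2]] : exists v, [/\ end_point aY (phi x) v = phi (aX x l),
    (size v <= k)%N &
    forall z, path_sum aY z (phi x) v = step_sum aX (pullback z) x l].
  exists (v ++ w'); split=> [||z].
  - by rewrite end_point_cat e2 e1.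
  - by rewrite size_cat /= mulSn leq_add.
  - by rewrite path_sum_cat e2 p2 p1.
case: l {w' e1 s1 p1 IH} => s [].
  have := uP (aX x (s, true)) s; rewrite (aXK x (s, true)) => e.
  exists (inv_word (u (aX x (s, true), s))); split=> [||z].
  - by rewrite e end_point_inv.
  - by rewrite size_inv_word.
  - by rewrite {1}e path_sum_inv.
by exists (u (x, s)); rewrite -uP.
Qed.

End Pullback.

(** * Dimension of the space of coboundaries *)

Section Euler.
Variables (X : finType) (aX : X -> letter -> X).
Hypothesis aXK : forall x l, aX (aX x l) (inv_letter l) = x.
Local Notation C0 := {ffun X -> rat^o}.
Local Notation C1 := {ffun X * bool -> rat^o}.

Definition coboundary_ffun (f : C0) : C1 := [ffun e => coboundary aX f e].

Lemma coboundary_linear : linear coboundary_ffun.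
Proof.
move=> a f g; apply/ffunP=> e; rewrite !ffunE /coboundary !ffunE.
by rewrite scalerBr opprD addrACA.
Qed.
HB.instance Definition _ :=
  GRing.isLinear.Build rat C0 C1 *:%R coboundary_ffun coboundary_linear.

Definition coboundary_hom : 'Hom(C0, C1) := linfun coboundary_ffun.

(** A function with zero coboundary takes equal values at both ends of any path, so on a connected
    graph it is constant. *)
Lemma dim_lker_coboundary (x0 : X) :
  word_connected aX -> \dim (lker coboundary_hom) = 1.
Proof.
move=> cX; pose one : C0 := [ffun=> 1].
suff -> : lker coboundary_hom = <[one]>%VS.
  rewrite dim_vline; suff -> : one != 0 by [].
  by apply/eqP=> /ffunP/(_ x0); rewrite !ffunE.
apply/eqP; rewrite eqEsubv; apply/andP; split; apply/subvP=> f.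
  rewrite memv_ker lfunE /= => /eqP/ffunP df; apply/vlineP; exists (f x0).
  apply/ffunP=> x; rewrite !ffunE [_ *: _]mulr1.
  have [w ->] := cX x0 x.
  apply/eqP; rewrite -subr_eq0 -(path_sum_coboundary aXK).
  have {}df e : coboundary aX f e = 0 by have := df e; rewrite !ffunE.
  elim: w (x0) => //= l w IH x1; rewrite (eqP (IH _)) addr0 /step_sum !df.
  by case: ifP; rewrite ?oppr0.
case/vlineP=> a ->; rewrite memv_ker lfunE /=; apply/eqP/ffunP=> e.
by rewrite !ffunE /coboundary !ffunE subrr.
Qed.

Lemma dim_limg_coboundary (x0 : X) :
  word_connected aX -> (\dim (limg coboundary_hom)).+1 = #|X|.
Proof.
move=> cX; have := limg_ker_dim coboundary_hom fullv.
rewrite capfv (dim_lker_coboundary x0 cX) add1n => ->.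
by rewrite dimvf /dim /= muln1.
Qed.

End Euler.

(** * Comparison of first cohomology groups *)

Section Rank.
Variables (X Y : finType).
Variables (aX : X -> letter -> X) (aY : Y -> letter -> Y).
Hypothesis aXK : forall x l, aX (aX x l) (inv_letter l) = x.
Hypothesis aYK : forall x l, aY (aY x l) (inv_letter l) = x.

(** Pulling back along [psi] embeds the first cohomology of [X] into that of [Y], because pulling
    back further along [phi] acts as the identity on classes. The dimensions are [#|X| + 1] and
    [#|Y| + 1]. *)
Lemma leq_card_of_coarse_inverse k (phi : X -> Y) (psi : Y -> X) (x0 : X) :
  word_connected aX -> word_connected aY ->
  locally_free rat^o aX (k + k * k + k.+1) ->
  (forall x s, word_near aY k (phi x) (phi (aX x (s, false)))) ->
  (forall y s, word_near aX k (psi y) (psi (aY y (s, false)))) ->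
  (forall x, word_near aX k x (psi (phi x))) ->
  (#|X| <= #|Y|)%N.
Proof.
move=> cX cY freeX nphi npsi npp.
have /fin_all_exists2[u uk uP] : forall e : X * bool, exists2 w, (size w <= k)%N &
  phi (aX e.1 (e.2, false)) = end_point aY (phi e.1) w by move=> e; apply: nphi.
have /fin_all_exists2[v vk vP] : forall e : Y * bool, exists2 w, (size w <= k)%N &
  psi (aY e.1 (e.2, false)) = end_point aX (psi e.1) w by move=> e; apply: npsi.
have vP' y s : psi (aY y (s, false)) = end_point aX (psi y) (v (y, s)).
  exact: (vP (y, s)).
have /fin_all_exists2[t tk tP] := npp.
pose B (z : {ffun X * bool -> rat^o}) : {ffun Y * bool -> rat^o} :=
  [ffun e => pullback aX psi v z e].
have path_sumL (a : rat) (z z' : {ffun X * bool -> rat^o}) x w :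
    path_sum aX (a *: z + z') x w =
    a * path_sum aX z x w + path_sum aX z' x w.
  elim: w x => [|l w IH] x /=; first by rewrite mulr0 addr0.
  rewrite IH mulrDr addrACA; congr (_ + _); rewrite /step_sum.
  by case: ifP; rewrite !ffunE // opprD mulrN.
have B_linear : linear B.
  by move=> a z z'; apply/ffunP=> e; rewrite !ffunE /pullback path_sumL.
pose BL := GRing.isLinear.Build rat _ _ *:%R B B_linear.
pose Bl : {linear _ -> _} := HB.pack B BL.
pose Bh := linfun Bl.
(* Pulling [z] back along [psi], then along [phi], adds to it the coboundary
   of its sums over the short paths [t x] from [x] to [psi (phi x)]. *)
have key (z : {ffun X * bool -> rat^o}) :
    Bh z \in limg (coboundary_hom aY) -> z \in limg (coboundary_hom aX).
  case/memv_imgP => h _; rewrite !lfunE /= => Bz.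
  pose g : {ffun X -> rat^o} := [ffun x => h (phi x) - path_sum aX z x (t x)].
  apply/memv_imgP; exists g; rewrite ?memvf // lfunE /=.
  apply/ffunP=> -[x s]; rewrite !ffunE /coboundary /= !ffunE.
  have [w' [e1 s1 p1]] := path_sum_pullback rat^o aYK aXK vP' vk
    (phi x) (u (x, s)).
  (* The path [w'] follows the image under [psi] of the path [u (x, s)]. As the pullback of [z]
     along [psi] is the coboundary of [h], the sum telescopes. *)
  have pB : path_sum aX z (psi (phi x)) w' =
      h (phi (aX x (s, false))) - h (phi x).
    rewrite p1.
    have -> : path_sum aY (pullback aX psi v z) (phi x) (u (x, s)) =
      path_sum aY (coboundary aY h) (phi x) (u (x, s)).
      have E e : pullback aX psi v z e = coboundary aY h e.
        by have := congr1 (fun F : {ffun _ -> _} => F e) Bz; rewrite !ffunE.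
      elim: (u _) (phi x) => //= l w IH y; rewrite IH; congr (_ + _).
      by rewrite /step_sum !E.
    by rewrite path_sum_coboundary // -(uP (x, s)).
  (* Two paths lead from [x] to [psi (phi (aX x (s, false)))]: one of length at most [k + k * k]
     through [psi (phi x)], the other of length at most [k.+1] through the neighbour of [x]. *)
  have := freeX z x (t x ++ w') ((s, false) :: t (aX x (s, false))).
  rewrite path_sum_cat -(tP x) pB /= /step_sum /= => free.
  apply: (addIr (path_sum aX z (aX x (s, false)) (t (aX x (s, false))))).
  rewrite -free; first by ring.
  - rewrite size_cat -addnA leq_add // (leq_trans s1) //.
    rewrite (@leq_trans (k * k)) ?leq_addr //.
    by rewrite leq_mul2r uk orbT.
  - by apply: leq_trans (leq_addl _ _); rewrite /= ltnS.
  - by rewrite end_point_cat -tP e1 -(uP (x, s)) /= tP.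
set imX := limg (coboundary_hom aX) in key *.
set imY := limg (coboundary_hom aY) in key *.
(* The complement [imX^C] models the first cohomology of [X]. By [key], [Bh] is injective on it and
   its image meets [imY] trivially. *)
have dW : \dim (Bh @: imX^C) = \dim (imX^C)%VS.
  have := limg_ker_dim Bh imX^C.
  suff -> : (imX^C :&: lker Bh)%VS = 0%VS by rewrite dimv0 add0n.
  apply/eqP; rewrite -subv0 -(capv_compl imX) capvC; apply: capvS => //.
  apply/subvP=> z; rewrite memv_ker => /eqP Bz.
  by apply: key; rewrite Bz mem0v.
have capW : (Bh @: imX^C :&: imY)%VS = 0%VS.
  apply/eqP; rewrite -subv0; apply/subvP=> y; rewrite memv_cap => /andP[].
  case/memv_imgP=> z Wz -> /key zd.
  have : z \in (imX :&: imX^C)%VS by rewrite memv_cap zd.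
  by rewrite capv_compl memv0 => /eqP ->; rewrite linear0 mem0v.
(* This amounts to [(#|X| + 1) + (#|Y| - 1) <= 2 * #|Y|]. The bound on [\dim imX] below makes the
   truncated subtraction in the dimension of [imX^C] exact. *)
have := dimvS (subvf (Bh @: imX^C + imY)%VS).
rewrite dimv_disjoint_sum // dW dimv_compl !dimvf /dim /= !muln1 !card_prod card_bool.
have := dim_limg_coboundary aXK x0 cX.
have := dim_limg_coboundary aYK (phi x0) cY; rewrite -/imX -/imY.
have := dimvS (subvf imX).
rewrite dimvf /dim /= muln1 card_prod card_bool; lia.
Qed.
End Rank.

(** * Freeness of the Sanov matrices *)

(* [[1, 2], [0, 1]] for index [false] and its transpose for index [true]. *)
Definition sanov_gen (l : letter) : 'M[int]_2 :=
  \matrix_(i, j) (if i == j then 1 else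
    if (i == ord0) (+) l.1 then (if l.2 then -2 else 2) else 0).

Definition word_mx (w : seq letter) : 'M[int]_2 := \prod_(l <- w) sanov_gen l.

Lemma ord2E (i : 'I_2) : i = ord0 \/ i = ord_max.
Proof. by case: i => [[|[|]]] // ?; [left|right]; apply: val_inj. Qed.

Lemma sanov_gen_mul l (M : 'M[int]_2) :
  let c := if l.2 then -2 else 2 in
  (forall j, (sanov_gen l * M) ord0 j =
     M ord0 j + (if l.1 then 0 else c * M ord_max j)) *
  (forall j, (sanov_gen l * M) ord_max j =
     M ord_max j + (if l.1 then c * M ord0 j else 0)).
Proof.
have F (f : 'I_2 -> int) : \sum_i f i = f ord0 + f ord_max.
  by rewrite big_ord_recl big_ord1; congr (_ + f _); apply: val_inj.
by case: l => [] [] [] /=; split=> j; rewrite mxE F !mxE /=;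
  rewrite ?mul1r ?mul0r ?add0r ?addr0 // addrC.
Qed.

Lemma word_mx_cons l w : word_mx (l :: w) = sanov_gen l * word_mx w.
Proof. exact: big_cons. Qed.

Lemma word_mx_cat w1 w2 : word_mx (w1 ++ w2) = word_mx w1 * word_mx w2.
Proof. exact: big_cat. Qed.

Lemma word_mx1 l : word_mx [:: l] = sanov_gen l.
Proof. exact: big_seq1. Qed.

Lemma sanov_gen_inv l : sanov_gen l * sanov_gen (inv_letter l) = 1.
Proof.
apply/matrixP=> i j; case: (ord2E i) => ->; rewrite sanov_gen_mul;
by case: (ord2E j) => ->; case: l => [] [] []; rewrite !mxE.
Qed.

Lemma word_mx_inv w : word_mx w * word_mx (inv_word w) = 1.
Proof.
elim: w => [|l w IH]; first by rewrite /word_mx !big_nil mulr1.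
rewrite inv_word_cons -cats1 word_mx_cat word_mx_cons word_mx1 mulrA.
rewrite -(mulrA _ (word_mx w)) IH.
by rewrite mulr1 sanov_gen_inv.
Qed.

Lemma inv_wordK : involutive inv_word.
Proof. by move=> w; rewrite /inv_word map_rev revK mapK //; apply: inv_letterK. Qed.

Lemma word_mx_invl w : word_mx (inv_word w) * word_mx w = 1.
Proof. by have := word_mx_inv (inv_word w); rewrite inv_wordK. Qed.

(** Each letter adds to one row plus or minus twice the other, so the largest entry at most
    triples. *)
Lemma word_mx_bound w i j : `|word_mx w i j| <= 3 ^+ size w.
Proof.
elim: w i => [|l w IH] i.
  by rewrite /word_mx big_nil mxE expr0; case: eqP.
rewrite word_mx_cons exprS; have := IH ord0; have := IH ord_max.
set m := 3 ^+ size w; case: (ord2E i) => ->; rewrite sanov_gen_mul;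
by case: l => [] [] [] /=; lia.
Qed.

Definition reduced (w : seq letter) := sorted (fun l l' => l' != inv_letter l) w.

(* The cone into which a reduced word with first letter [l] sends the basis
   vector moved by its last letter. *)
Definition ping_pong (l : letter) (x y : int) :=
  let s z := if l.2 then - z else z in
  if l.1 then (0 < s x < y) || (y < s x < 0) else (0 < s y < x) || (x < s y < 0).

(** Induction on the word: the row operation of a letter maps the cone of every letter except its
    inverse into its own cone. *)
Lemma word_mx_ping_pong l w : reduced (l :: w) ->
  let j := if (last l w).1 then ord0 else ord_max in
  ping_pong l (word_mx (l :: w) ord0 j) (word_mx (l :: w) ord_max j).
Proof.
elim: w l => [|l' w IH] l.
  rewrite word_mx1 /ping_pong => _ /=.
  by case: l => [] [] [] /=; rewrite !mxE.
move=> /= /andP[l'l /IH{IH}] /=; set j := if _ then _ else _.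
rewrite (word_mx_cons l) !sanov_gen_mul.
move: (word_mx _ _ _) (word_mx _ _ _) => x y.
by move: l'l; case: l => [] [] []; case: l' {j} => [] [] [] //= _;
  rewrite /ping_pong /=; lia.
Qed.

(** Vectors in a cone have two nonzero coordinates, unlike the columns of the identity. *)
Lemma word_mx_reduced_neq1 l w : reduced (l :: w) -> word_mx (l :: w) <> 1.
Proof.
move=> /word_mx_ping_pong + e; rewrite e /ping_pong; case: (last l w).1;
by rewrite !mxE /=; case: l {e} => [] [] [].
Qed.

Lemma not_reducedP w : ~~ reduced w ->
  exists w1 l w2, w = w1 ++ [:: l, inv_letter l & w2].
Proof.
elim: w => [|l [|l' w] IH] //=; rewrite negb_and negbK => /orP[/eqP ->|].
  by exists [::], l, w.
by case/IH=> w1 [m [w2 ->]]; exists (l :: w1), m, w2.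
Qed.

Section Free.
Variables (V : zmodType) (X : Type) (act : X -> letter -> X).
Hypothesis actK : forall x l, act (act x l) (inv_letter l) = x.

(** This is freeness in cochain form: a nonempty word with trivial matrix contains two adjacent
    inverse letters, and deleting them changes neither the matrix nor the path sum. *)
Lemma word_mx1_path_sum (z : X * bool -> V) x w :
  word_mx w = 1 -> path_sum act z x w = 0.
Proof.
elim: {w}(size w) {-2}w (leqnn (size w)) => [|n IH] w.
  by rewrite leqn0 size_eq0 => /eqP ->.
move=> sw w1; have [|/not_reducedP[u [l [v e]]]] := boolP (reduced w).
  by case: w w1 {sw} => // l w w1 /word_mx_reduced_neq1.
have e1 : path_sum act z x w = path_sum act z x (u ++ v).
  by rewrite e !path_sum_cat /= actK step_sum_inv // addNKr.
rewrite e1; apply: IH.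
  by move: sw; rewrite e !size_cat /=; lia.
move: w1; rewrite e !word_mx_cat !word_mx_cons (mulrA (sanov_gen _)).
by rewrite sanov_gen_inv mul1r.
Qed.

Lemma word_mx_path_sum (z : X * bool -> V) x w1 w2 : word_mx w1 = word_mx w2 ->
  end_point act x w1 = end_point act x w2 ->
  path_sum act z x w1 = path_sum act z x w2.
Proof.
move=> e12 p12; apply/eqP; rewrite -subr_eq0 -(path_sum_inv actK _ _ w2) -p12.
by rewrite -path_sum_cat word_mx1_path_sum // word_mx_cat e12 word_mx_inv.
Qed.

End Free.

(** * The Sanov group *)

(** Membership is a boolean, so that elements with equal matrices are equal. *)
Record sanov := Sanov { mat : 'M[int]_2; matP : `[< exists w, mat = word_mx w >] }.

HB.instance Definition _ := [isSub for mat].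
HB.instance Definition _ := [Choice of sanov by <:].

Lemma mat_inj : injective mat.
Proof. exact: val_inj. Qed.

Fact word_elt_subproof w : `[< exists v, word_mx w = word_mx v >].
Proof. by apply/asboolP; exists w. Qed.

Definition word_elt (w : seq letter) : sanov := Sanov (word_elt_subproof w).

Lemma word_eltP (g : sanov) : exists w, g = word_elt w.
Proof. by case: g => M /[dup] /asboolP[w ->] Mw; exists w; apply: val_inj. Qed.

Definition word_of (g : sanov) : seq letter := projT1 (cid (word_eltP g)).

Lemma word_ofK (g : sanov) : word_elt (word_of g) = g.
Proof. by rewrite /word_of; case: cid. Qed.

Lemma word_mx_word_of (g : sanov) : word_mx (word_of g) = mat g.
Proof. by rewrite -[in RHS](word_ofK g). Qed.

(** Operating on chosen words makes closure under products and inverses immediate; the group laws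
    are then checked on matrices. *)
Definition sanov_mul (g h : sanov) := word_elt (word_of g ++ word_of h).
Definition sanov_one := word_elt [::].
Definition sanov_inv (g : sanov) := word_elt (inv_word (word_of g)).

Lemma mat_mul g h : mat (sanov_mul g h) = mat g * mat h.
Proof. by rewrite /= word_mx_cat !word_mx_word_of. Qed.

Lemma mat_one : mat sanov_one = 1.
Proof. exact: big_nil. Qed.

Fact sanov_mulA : associative sanov_mul.
Proof. by move=> f g h; apply: mat_inj; rewrite !mat_mul mulrA. Qed.
Fact sanov_mul1 : left_id sanov_one sanov_mul.
Proof. by move=> g; apply: mat_inj; rewrite mat_mul mat_one mul1r. Qed.
Fact sanov_mulr1 : right_id sanov_one sanov_mul.
Proof. by move=> g; apply: mat_inj; rewrite mat_mul mat_one mulr1. Qed.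
Fact sanov_mulV : left_inverse sanov_one sanov_inv sanov_mul.
Proof.
move=> g; apply: mat_inj; rewrite mat_mul mat_one -[in X in _ * X](word_ofK g).
exact: word_mx_invl.
Qed.
Fact sanov_mulrV : right_inverse sanov_one sanov_inv sanov_mul.
Proof.
move=> g; apply: mat_inj; rewrite mat_mul mat_one -[in X in X * _](word_ofK g).
exact: word_mx_inv.
Qed.

HB.instance Definition _ := isGroup.Build sanov
  sanov_mulA sanov_mul1 sanov_mulr1 sanov_mulV sanov_mulrV.

(** * Congruence subgroups *)

Lemma matM (g h : sanov) : mat (g * h)%g = mat g * mat h.
Proof. exact: mat_mul. Qed.

Lemma mat1 : mat 1%g = 1.
Proof. exact: mat_one. Qed.

Lemma one_mxE (i j : 'I_2) : (1 : 'M[int]_2) i j = if i == j then 1 else 0.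
Proof. by rewrite mxE; case: (i == j). Qed.

Lemma word_elt_cat w1 w2 : word_elt (w1 ++ w2) = (word_elt w1 * word_elt w2)%g.
Proof. by apply: mat_inj; rewrite matM /= word_mx_cat. Qed.

(** The exponent [n.+1] keeps the modulus at least 2, as needed for ['Z_(modulus n)] to be the
    integers modulo [modulus n]. *)
Definition modulus n := (2 ^ n.+1)%N.

Lemma modulus_gt1 n : (1 < modulus n)%N.
Proof. by rewrite /modulus -{1}(expn0 2) ltn_exp2l. Qed.

Lemma intr_Zp_eq0 m (z : int) : (1 < m)%N ->
  (z%:~R == 0 :> 'Z_m) = (m %| `|z|)%N.
Proof.
move=> m1; have nE (n : nat) : (n%:R == 0 :> 'Z_m) = (m %| n)%N.
  apply/eqP/idP => [/(congr1 val)|mn]; first by rewrite /= val_Zp_nat // => /eqP.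
  by apply: val_inj; rewrite /= val_Zp_nat //; apply/eqP.
case: (intP z) => [|n|n]; rewrite ?dvdn0 ?eqxx //.
  exact: (nE n.+1).
by rewrite rmorphN oppr_eq0 abszN; exact: (nE n.+1).
Qed.

Definition red n (M : 'M[int]_2) : 'M['Z_(modulus n)]_2 := map_mx intr M.

Lemma redM n M M' : red n (M * M') = red n M * red n M'.
Proof. exact: map_mxM. Qed.

Lemma red1 n : red n 1 = 1.
Proof. exact: map_mx1. Qed.

Lemma red_eqP n M M' : red n M = red n M' <->
  forall i j, (modulus n %| absz (M i j - M' i j)%R)%N.
Proof.
split=> [e i j|e].
  rewrite -intr_Zp_eq0 ?modulus_gt1 // rmorphB subr_eq0; apply/eqP.
  by have := congr1 (fun A : 'M__ => A i j) e; rewrite !mxE.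
apply/matrixP=> i j; rewrite !mxE; apply/eqP; rewrite -subr_eq0 -rmorphB.
by rewrite intr_Zp_eq0 ?modulus_gt1.
Qed.

Lemma red_eq_small n M M' : red n M = red n M' ->
  (forall i j, `|M i j - M' i j| < (modulus n)%:Z) -> M = M'.
Proof.
move=> /red_eqP e small; apply/matrixP=> i j; apply/eqP; rewrite -subr_eq0 -absz_eq0.
have := small i j; have := e i j; rewrite -abszE ltz_nat => d lt.
by move: d; rewrite /dvdn modn_small.
Qed.

Lemma red_eqS n M M' : red n.+1 M = red n.+1 M' -> red n M = red n M'.
Proof.
move=> /red_eqP e; apply/red_eqP => i j; apply: dvdn_trans (e i j).
by rewrite /modulus [(2 ^ n.+2)%N]expnS dvdn_mull.
Qed.

(** Corresponding entries differ by at most [2 * 3 ^ L], too little for a nonzero multiple of the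
    modulus. This is what makes the girth of the quotients tend to infinity. *)
Lemma red_word_inj n L w1 w2 : (2 * 3 ^ L < modulus n)%N ->
  (size w1 <= L)%N -> (size w2 <= L)%N ->
  red n (word_mx w1) = red n (word_mx w2) -> word_mx w1 = word_mx w2.
Proof.
move=> Ln s1 s2 /red_eq_small; apply=> i j.
have b w : (size w <= L)%N -> `|word_mx w i j| <= (3 ^ L)%N%:Z.
  move=> sw; apply: le_trans (word_mx_bound _ _ _) _.
  by rewrite -natrX natz lez_nat leq_exp2l.
by have := b _ s1; have := b _ s2; move: (3 ^ L)%N Ln => a; lia.
Qed.

Lemma modulus_large k : exists J, forall n, (J <= n)%N -> (k < modulus n)%N.
Proof.
exists k => n kn; apply: leq_trans (leq_pexp2l (isT : 0 < 2)%N (leqW kn)).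
exact: ltn_expl.
Qed.

Definition rho n (g : sanov) := red n (mat g).

Lemma rhoM n g h : rho n (g * h)%g = rho n g * rho n h.
Proof. by rewrite /rho matM redM. Qed.

Lemma rho1 n : rho n 1%g = 1.
Proof. by rewrite /rho mat1 red1. Qed.

Lemma rhoVM n g : rho n g^-1%g * rho n g = 1.
Proof. by rewrite -rhoM mulVg rho1. Qed.

Definition cong n : set sanov := [set g | rho n g = 1].

Lemma rho_mulI n g M M' : rho n g * M = rho n g * M' -> M = M'.
Proof.
by move=> e; rewrite -[M]mul1r -[M']mul1r -(rhoVM n g) -!mulrA e.
Qed.

Lemma cong_normal n : is_normal (cong n).
Proof.
split.
  split; first by rewrite inE /cong /= rho1.
  move=> x y; rewrite !inE /cong /= rhoM => -> e; rewrite mul1r.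
  by rewrite -[LHS]mulr1 -e rhoVM.
move=> x g; rewrite /cong /= conjgE !rhoM => ->.
by rewrite mul1r rhoVM.
Qed.

Lemma left_coset_cong n g : left_coset g (cong n) = [set h | rho n h = rho n g].
Proof.
apply/seteqP; split=> h /=.
  by case=> k; rewrite /cong /= => k1 <-; rewrite rhoM k1 mulr1.
move=> e; exists (g^-1 * h)%g; last by rewrite mulVKg.
by rewrite /cong /= rhoM e rhoVM.
Qed.

Lemma cong_finite_index n : finite_index (cong n).
Proof.
pose F (M : 'M['Z_(modulus n)]_2) := [set h | rho n h = M].
apply: (@sub_finite_set _ _ (F @` setT)).
  by move=> _ [g _ <-]; exists (rho n g); rewrite ?left_coset_cong.
exact/finite_image/finite_finset.
Qed.

Lemma cong_decr n : cong n.+1 `<=` cong n.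
Proof. by move=> g; rewrite /cong /= -rho1 -(rho1 n) => /red_eqS. Qed.

Lemma cong_le m n : (m <= n)%N -> cong n `<=` cong m.
Proof.
by move/subnK <-; elim: (n - m)%N => // k IH g; rewrite addSn => /cong_decr/IH.
Qed.

Lemma cong_separates (g : sanov) : g <> 1%g ->
  exists J, forall n, (J <= n)%N -> ~ cong n g.
Proof.
move=> g1; have [J PJ] := modulus_large (2 * 3 ^ size (word_of g)).
exists J => n /PJ Jn; rewrite /cong /= -(rho1 n) => e; apply: g1.
apply: mat_inj; rewrite mat1 -word_mx_word_of -[RHS](mat_one).
apply: red_word_inj Jn _ _ _ => //.
by rewrite word_mx_word_of [red n (mat g)]e /rho mat1 /= /word_mx big_nil.
Qed.

Lemma cong_filtration (f : nat -> nat) : (forall i, (f i < f i.+1)%N) ->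
  is_filtration (cong \o f).
Proof.
move=> f_incr; split=> [i|i|i|] /=.
- exact/cong_le/ltnW.
- exact: cong_normal.
- exact: cong_finite_index.
apply/seteqP; split=> g /=; last by move=> -> i _; rewrite /cong /= rho1.
move=> gf; apply: contrapT => /cong_separates[J /(_ (f J))]; apply.
  (* A strictly increasing [f] satisfies [J <= f J]. *)
  by elim: (J) => // k IH; apply: leq_ltn_trans IH _.
exact: gf.
Qed.

Lemma sanov_residually_finite : residually_finite sanov.
Proof.
move=> g /cong_separates[J /(_ J (leqnn J)) ?]; exists (cong J); split=> //.
  exact: cong_normal.
exact: cong_finite_index.
Qed.

Definition gen_elt l := word_elt [:: l].

Lemma word_elt_cons l w : word_elt (l :: w) = (gen_elt l * word_elt w)%g.
Proof. exact: (word_elt_cat [:: l]). Qed.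

Lemma word_elt_nil : word_elt [::] = 1%g.
Proof. by []. Qed.

Lemma sanov_finitely_generated : finitely_generated sanov.
Proof.
exists (gen_elt @` setT); first exact/finite_image/finite_finset.
apply/seteqP; split=> // g _ H [Hsub HS]; have [w ->] := word_eltP g.
elim: w => [|l w IH].
  by have := Hsub.1; rewrite inE -word_elt_nil.
rewrite word_elt_cons; have := group_closedM Hsub; move/(_ (gen_elt l) (word_elt w)).
by rewrite !inE; apply=> //; apply: HS; exists l.
Qed.

(** The element [A_power (2 ^ n)] lies in [cong n] but not in [cong n.+1]. It separates the orders
    of consecutive quotients and provides points far from the identity. *)
Definition A_power n := word_elt (nseq n (false, false)).

Lemma mat_A_power n : mat (A_power n) =
  \matrix_(i, j) (if i == j then 1 else if i == ord0 then (2 * n)%N%:Z else 0).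
Proof.
rewrite /=; elim: n => [|n IH].
  by apply/matrixP=> i j; rewrite /word_mx big_nil !mxE; case: eqP => //; case: eqP.
rewrite /= word_mx_cons; apply/matrixP=> i j.
case: (ord2E i) => ->; rewrite sanov_gen_mul /= IH !mxE /=;
by case: (ord2E j) => -> /=; lia.
Qed.

Lemma rho_A_power n : rho n (A_power (2 ^ n)) = 1.
Proof.
rewrite -(rho1 n); apply/red_eqP => i j; rewrite mat_A_power mat1 one_mxE mxE.
case: (i == j); rewrite ?subrr ?dvdn0 // subr0; case: (_ == _) => //.
by rewrite absz_nat /modulus expnS.
Qed.

(* The entry [2 ^ n.+1] of [A_power (2 ^ n)] does not vanish modulo [2 ^ n.+2],
   and no word of length [k] has an entry of this size up to sign. *)
Lemma A_power_far n k w : (2 * 3 ^ k < modulus n)%N -> (size w <= k)%N ->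
  rho n.+1 (A_power (2 ^ n)) <> rho n.+1 (word_elt w).
Proof.
move=> kn wk /red_eqP/(_ ord0 ord_max); rewrite mat_A_power !mxE /=.
have : `|word_mx w ord0 ord_max| <= (3 ^ k)%N%:Z.
  apply: le_trans (word_mx_bound _ _ _) _.
  by rewrite -natrX natz lez_nat leq_exp2l.
move: kn; rewrite /modulus [(2 ^ n.+2)%N]expnS [(2 ^ n.+1)%N]expnS.
move: (2 ^ n)%N (3 ^ k)%N (word_mx _ _ _) => a b c ab cb.
(* From [|c| <= b < a] follows [0 < 2 * a - c < 4 * a], so the difference is not a multiple of the
   modulus [4 * a]. *)
case/dvdnP => q; case: q => [|q]; first by lia.
by rewrite mulSn => e; have : (q * (2 * (2 * a)) >= 0)%N by []; lia.
Qed.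

Lemma A_power_notin n : rho n.+1 (A_power (2 ^ n)) <> 1.
Proof.
move=> /eqP; rewrite -(rho1 n.+1) => /eqP/red_eqP/(_ ord0 ord_max).
rewrite mat_A_power mat1 one_mxE mxE /= addn0 -expnS => /dvdn_leq.
by rewrite expn_gt0 /= /modulus leq_exp2l // ltnn => /(_ isT).
Qed.

Lemma dvdn_double_sub m (a b : int) : (0 < m)%N ->
  (m %| absz a)%N -> (m %| absz b)%N ->
  (2 * m %| absz (a - b)%R)%N = (odd (absz a %/ m) == odd (absz b %/ m)).
Proof.
move=> m0 ma mb; have /dvdzP[p ->] : (m%:Z %| a)%Z by [].
have /dvdzP[q ->] : (m%:Z %| b)%Z by [].
rewrite -mulrBl !abszM !absz_nat !mulnK // dvdn_pmul2r // dvdn2; lia.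
Qed.

(** For [g] in [cong n], the entries of [mat g - 1] are multiples of [modulus n], and the parities
    of the four quotients determine [g] modulo [modulus n.+1]. Hence at most 16 cosets, whatever [n]
    is. *)
Lemma cong_index n :
  index_le (cong n) (cong n.+1) #|{: {ffun 'I_2 * 'I_2 -> bool}}|.
Proof.
pose d (g : sanov) (i j : 'I_2) := mat g i j - (1 : 'M[int]_2) i j.
pose code g := [ffun ij : 'I_2 * 'I_2 => odd (absz (d g ij.1 ij.2) %/ modulus n)].
pose F (c : {ffun 'I_2 * 'I_2 -> bool}) := [set g | cong n g /\ code g = c].
have congP g : cong n g <-> forall i j, (modulus n %| absz (d g i j))%N.
  by rewrite -red_eqP red1.
have codeP g h : cong n g -> cong n h ->
    rho n.+1 h = rho n.+1 g <-> code h = code g.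
  move=> /congP gn /congP hn; rewrite red_eqP.
  have E i j : (modulus n.+1 %| absz (mat h i j - mat g i j)%R)%N =
      (code h (i, j) == code g (i, j)).
    rewrite !ffunE -dvdn_double_sub ?expn_gt0 // /modulus -expnS.
    by rewrite /d opprB addrA subrK.
  split=> [e|e i j]; last by rewrite E e.
  by apply/ffunP=> -[i j]; apply/eqP; rewrite -E.
rewrite /index_le; apply: (@card_le_trans _ _ _ (F @` setT)).
  apply: subset_card_le => _ [g gn <-]; exists (code g) => //.
  rewrite left_coset_cong; apply/seteqP; split=> h /=.
    by case=> hn /(codeP g h gn hn).
  move=> hg; have hn : cong n h.
    by move: gn; rewrite /cong /= /rho (red_eqS hg).
  by split=> //; apply/(codeP g h gn hn).
apply: card_le_trans (card_image_le _ _) _.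
rewrite (card_le_eqr card_II).
apply: card_le_trans (card_image_le enum_val setT).
by apply: subset_card_le => c _; exists (enum_rank c); rewrite ?enum_rankK.
Qed.

(** * Finite quotients *)

Section CosetType.
Variable n : nat.

Definition coset_type := quotient (cong n).

Fact coset_subproof g : left_coset g (cong n) \in cosets setT (cong n).
Proof. by rewrite inE; exists g. Qed.

Definition coset g : coset_type :=
  exist (fun C => C \in cosets setT (cong n)) _ (coset_subproof g).

Lemma coset_surj (x : coset_type) : exists g, x = coset g.
Proof.
by have /set_mem[g _ e] := valP x; exists g; apply: val_inj.
Qed.

Definition coset_rep (x : coset_type) := projT1 (cid (coset_surj x)).

Lemma coset_repK x : coset (coset_rep x) = x.
Proof. by rewrite /coset_rep; case: cid. Qed.

Lemma coset_eqP g h : coset g = coset h <-> rho n g = rho n h.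
Proof.
split=> [/(congr1 val)|e]; last first.
  by apply: val_inj; rewrite /= !left_coset_cong e.
rewrite /= !left_coset_cong => /seteqP[+ _] => /(_ g); exact.
Qed.

Lemma rho_coset_rep g : rho n (coset_rep (coset g)) = rho n g.
Proof. by apply/coset_eqP; rewrite coset_repK. Qed.

HB.instance Definition _ := Choice.on coset_type.

Definition rhoq (x : coset_type) := rho n (coset_rep x).

(** Reduction embeds the cosets into matrices over a finite ring, which yields the finite type
    structure; off the image the value is arbitrary. *)
Definition rhoq_inv (M : 'M['Z_(modulus n)]_2) : coset_type :=
  if pselect (exists g, rho n g = M) is left e then coset (projT1 (cid e))
  else coset 1%g.

Lemma rhoqK : cancel rhoq rhoq_inv.
Proof.
move=> x; rewrite /rhoq_inv; case: pselect => [e|[]]; last by exists (coset_rep x).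
by rewrite -[RHS]coset_repK; apply/coset_eqP; case: cid.
Qed.

HB.instance Definition _ := Countable.copy coset_type (can_type rhoqK).
HB.instance Definition _ : isFinite coset_type := CanIsFinite rhoqK.

Definition coset_act (x : coset_type) (l : letter) : coset_type :=
  coset (coset_rep x * gen_elt l)%g.

Lemma coset_act_coset g l : coset_act (coset g) l = coset (g * gen_elt l)%g.
Proof. by apply/coset_eqP; rewrite !rhoM rho_coset_rep. Qed.

Lemma end_point_coset g w : end_point coset_act (coset g) w = coset (g * word_elt w)%g.
Proof.
elim: w g => [|l w IH] g; first by rewrite word_elt_nil mulg1.
rewrite -[LHS]/(end_point coset_act (coset_act (coset g) l) w) coset_act_coset IH.
by rewrite word_elt_cons mulgA.
Qed.

Lemma coset_actK x l : coset_act (coset_act x l) (inv_letter l) = x.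
Proof.
rewrite -(coset_repK x) !coset_act_coset -mulgA -word_elt_cons.
suff -> : word_elt [:: l; inv_letter l] = 1%g by rewrite mulg1.
by apply: mat_inj; rewrite mat1 /= word_mx_cons word_mx1 sanov_gen_inv.
Qed.

Lemma coset_connected : word_connected coset_act.
Proof.
move=> x y; exists (word_of ((coset_rep x)^-1 * coset_rep y)%g).
by rewrite -[X in end_point _ X _]coset_repK end_point_coset word_ofK mulVKg coset_repK.
Qed.

(** Short words with the same end points agree after reduction, hence as integer matrices, and
    freeness equates their path sums. *)
Lemma coset_locally_free (V : zmodType) L :
  (2 * 3 ^ L < modulus n)%N -> locally_free V coset_act L.
Proof.
move=> Ln z x w1 w2 s1 s2 e; apply: word_mx_path_sum => //; first exact: coset_actK.
apply: red_word_inj Ln s1 s2 _; apply: (@rho_mulI n (coset_rep x)).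
move: e; rewrite -{1 2}(coset_repK x) !end_point_coset => /coset_eqP.
by rewrite !rhoM.
Qed.

End CosetType.

(** The canonical surjection identifies the distinct classes of [A_power (2 ^ n)] and 1. *)
Lemma card_coset_typeS n : (#|{: coset_type n}| < #|{: coset_type n.+1}|)%N.
Proof.
pose f (x : coset_type n.+1) : coset_type n := coset n (coset_rep x).
have fE g : f (coset n.+1 g) = coset n g.
  by apply/coset_eqP; apply: red_eqS; apply: rho_coset_rep.
have f_surj y : y \in codom f.
  by rewrite -(coset_repK y) -fE codom_f.
have le : (#|{: coset_type n}| <= #|codom f|)%N.
  by apply: subset_leq_card; apply/fintype.subsetP.
rewrite ltn_neqAle (leq_trans le (leq_image_card _ _)) andbT.
apply/eqP=> e; have /image_injP inj : #|codom f| == #|{: coset_type n.+1}|.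
  by rewrite eqn_leq leq_image_card /= -e.
have := @A_power_notin n; rewrite -(rho1 n.+1) => /coset_eqP; apply.
apply: inj => //; rewrite !fE; apply/coset_eqP.
by rewrite rho_A_power rho1.
Qed.

Lemma card_coset_type_inj m n : #|{: coset_type m}| = #|{: coset_type n}| -> m = n.
Proof.
suff lt a b : (a < b)%N -> (#|{: coset_type a}| < #|{: coset_type b}|)%N.
  by case: (ltngtP m n) => // /lt; rewrite ltnNge => /negP + e; rewrite e leqnn.
elim: b => // b IH; rewrite ltnS leq_eqVlt => /orP[/eqP ->|/IH{}IH].
  exact: card_coset_typeS.
exact: ltn_trans IH (card_coset_typeS b).
Qed.

Lemma coset_far n k : (2 * 3 ^ k < modulus n)%N ->
  exists x y : coset_type n.+1, ~ word_near (@coset_act n.+1) k x y.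
Proof.
move=> kn; exists (coset _ 1%g), (coset _ (A_power (2 ^ n))) => -[w wk].
by rewrite end_point_coset mul1g => /coset_eqP; exact: (A_power_far kn wk).
Qed.

(** * Cayley graphs of the quotients *)

Section Walks.
Variables (T : Type) (e : T -> T -> Prop).

Lemma walk0 x : walk e 0 x x.
Proof. by exists (fun=> x). Qed.

Lemma walk1 x y : e x y -> walk e 1 x y.
Proof.
by move=> exy; exists (fun k => if k is 0 then x else y); split=> // -[] // _; left.
Qed.

Lemma walk_cat m n x y z : walk e m x y -> walk e n y z -> walk e (m + n) x z.
Proof.
case=> p [p0 pm pe] [q [q0 qn qe]].
exists (fun k => if (k <= m)%N then p k else q (k - m)%N); split=> //.
  case: leqP => [mn|_]; last by rewrite addKn.
  have n0 : n = 0%N by lia.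
  by rewrite n0 addn0 pm -q0 -n0 qn.
move=> k kmn; case: (ltngtP k m) => km.
- exact: pe.
- by rewrite subSn ?(ltnW km) //; apply: qe; lia.
- by rewrite km subSnn pm -q0; apply: qe; lia.
Qed.

Lemma walk_sym n x y : walk e n x y -> walk e n y x.
Proof.
case=> p [p0 pn pe]; exists (fun k => p (n - k)%N).
rewrite subn0 subnn; split=> // k kn.
have -> : (n - k = (n - k.+1).+1)%N by lia.
by have [] := pe (n - k.+1)%N ltac:(lia); [right|left].
Qed.

End Walks.

Section Near.
Variables (X : Type) (a : X -> letter -> X).
Hypothesis aK : forall x l, a (a x l) (inv_letter l) = x.

Lemma word_near_refl k x : word_near a k x x.
Proof. by exists [::]. Qed.

Lemma word_near_sym k x y : word_near a k x y -> word_near a k y x.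
Proof.
by case=> w wk ->; exists (inv_word w); rewrite ?size_inv_word ?end_point_inv.
Qed.

Lemma word_near_trans j k x y z :
  word_near a j x y -> word_near a k y z -> word_near a (j + k) x z.
Proof.
case=> v vj -> [w wk ->]; exists (v ++ w); rewrite ?end_point_cat //.
by rewrite size_cat leq_add.
Qed.

Lemma word_near_le j k x y : (j <= k)%N -> word_near a j x y -> word_near a k x y.
Proof. by move=> jk [w wj ->]; exists w => //; apply: leq_trans jk. Qed.

Lemma word_near1 x l : word_near a 1 x (a x l).
Proof. by exists [:: l]. Qed.

Lemma word_connected_ind (P : X -> Prop) x0 : word_connected a -> P x0 ->
  (forall x y, word_near a 1 x y -> P x -> P y) -> forall x, P x.
Proof.
move=> conn P0 PS x; have [w ->] := conn x0 x.
elim: w (x0) P0 => // l w IH y Py; apply: (IH (a y l)).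
exact: PS (word_near1 _ _) Py.
Qed.

End Near.

Lemma nat_fun_bounded (R : realType) (h : nat -> R) K :
  exists r : nat, forall m, (m <= K)%N -> h m <= r%:R.
Proof.
have bound m : h m <= (Num.bound `|h m|)%:R.
  exact: le_trans (ler_norm _) (ltW (archi_boundP (normr_ge0 _))).
elim: K => [|K [r rP]].
  by exists (Num.bound `|h 0%N|) => m; rewrite leqn0 => /eqP ->.
exists (maxn r (Num.bound `|h K.+1|)) => m.
rewrite leq_eqVlt => /orP[/eqP ->|/rP mr].
  by apply: le_trans (bound _) _; rewrite ler_nat leq_maxr.
by apply: le_trans mr _; rewrite ler_nat leq_maxl.
Qed.

Section CayleyGraph.
Variables (R : realType) (S : set sanov).
Hypotheses (finS : finite_set S) (genS : generates S).
Implicit Type n : nat.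

Local Notation edge n := (cayley_edge S (N := cong n)).

Lemma cayley_edge_coset n g s : S s -> edge n (coset n g) (coset n (g * s)%g).
Proof. by move=> Ss; exists g, s. Qed.

(** Since [S] is finite, the greatest length of chosen words for its elements serves as [K] for
    every [n]. With the converse below, Cayley distances and word lengths are comparable uniformly
    in the quotient. *)
Lemma walk_word_near : exists K, forall n m x y,
  walk (edge n) m x y -> word_near (@coset_act n) (m * K) x y.
Proof.
have [s sP] : exists s : seq sanov, S = [set` s] by apply/finite_seqP.
pose K := (\max_(g <- s) size (word_of g))%N; exists K => n.
have edge_near x y : edge n x y -> word_near (@coset_act n) K x y.
  case=> g [t [St ex ey]].
  have -> : x = coset n g by apply: val_inj.
  have -> : y = coset n (g * t)%g by apply: val_inj.
  exists (word_of t); last by rewrite end_point_coset word_ofK.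
  have ts : [set` s] t by rewrite -sP.
  exact: (leq_bigmax_seq t ts).
move=> m x y [p [<- <- pe]]; elim: m pe => [|m IH] pe.
  exact: word_near_refl.
rewrite mulSn addnC; apply: word_near_trans (IH _) _ => [k km|].
  exact/pe/ltnW.
by case: (pe m (ltnSn m)) => /edge_near //; apply: word_near_sym; apply: coset_actK.
Qed.

(** The elements with such a uniform [m] form a subgroup containing [S]. *)
Lemma elt_walk g : exists m, forall n h,
  walk (edge n) m (coset n h) (coset n (h * g)%g).
Proof.
pose P := [set g | exists m, forall n h,
  walk (edge n) m (coset n h) (coset n (h * g)%g)].
have Sg : smallest (@is_subgroup _) S g by rewrite genS.
apply: (Sg P); split; last first.
  by move=> s Ss; exists 1%N => n h; apply/walk1/cayley_edge_coset.
split; first by rewrite inE; exists 0%N => n h; rewrite mulg1; apply: walk0.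
move=> u v; rewrite !inE => -[mu wu] [mv wv]; exists (mu + mv)%N => n h.
rewrite mulgA; apply: walk_cat (wu n h) _; apply: walk_sym.
(* Reverse the walk that multiplies [h * u * v^-1] by [v]. *)
by have := wv n (h * u * v^-1)%g; rewrite mulgVK.
Qed.

Lemma word_near_walk : exists K, forall n k x y,
  word_near (@coset_act n) k x y -> exists2 m, (m <= k * K)%N & walk (edge n) m x y.
Proof.
have /fin_all_exists[K KP] := fun l : letter => elt_walk (gen_elt l).
exists (\max_l K l)%N => n k x _ [w wk ->].
suff [m mk wm] : exists2 m, (m <= size w * \max_l K l)%N &
    walk (edge n) m x (end_point (@coset_act n) x w).
  by exists m => //; apply: leq_trans mk _; rewrite leq_mul2r wk orbT.
elim: w x {wk} => [|l w IH] x; first by exists 0%N => //; apply: walk0.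
have [m mk wm] := IH (coset_act x l); exists (K l + m)%N.
  by rewrite mulSn leq_add // leq_bigmax.
by apply: walk_cat wm; rewrite -{1}(coset_repK x); apply: KP.
Qed.

Lemma coset_walk n x y : exists m, walk (edge n) m x y.
Proof.
have [w ->] := coset_connected x y; have [K] := word_near_walk.
by move=> /(_ n (size w) x (end_point (@coset_act n) x w))[|m _ ?]; [exists w|exists m].
Qed.

Lemma cayley_dist_le n m (x y : coset_type n) :
  walk (edge n) m x y -> cayley_dist R S x y <= m%:R.
Proof.
move=> wm; apply: ge_inf; last by exists m.
by exists 0 => _ [k _ <-].
Qed.

Lemma cayley_dist_attained n (x y : coset_type n) :
  exists2 m, walk (edge n) m x y & cayley_dist R S x y = m%:R.
Proof.
have ex : exists m, `[< walk (edge n) m x y >].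
  by have [m wm] := coset_walk x y; exists m; apply/asboolP.
case: (ex_minnP ex) => m /asboolP wm mmin; exists m => //.
apply/eqP; rewrite eq_le cayley_dist_le //=; apply: lb_le_inf; first by exists m%:R, m.
by move=> _ [k wk <-]; rewrite ler_nat; apply/mmin/asboolP.
Qed.

Lemma cayley_dist_ge0 n (x y : coset_type n) : 0 <= cayley_dist R S x y.
Proof. by have [m _ ->] := cayley_dist_attained x y. Qed.

Lemma dist_word_near : exists K, forall n k (x y : coset_type n),
  cayley_dist R S x y <= k%:R -> word_near (@coset_act n) (k * K) x y.
Proof.
have [K KP] := walk_word_near; exists K => n k x y.
have [m /KP wm ->] := cayley_dist_attained x y; rewrite ler_nat => mk.
by apply: word_near_le wm; rewrite leq_mul2r mk orbT.
Qed.

Lemma word_near_dist : exists K, forall n k (x y : coset_type n),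
  word_near (@coset_act n) k x y -> cayley_dist R S x y <= (k * K)%:R.
Proof.
have [K KP] := word_near_walk; exists K => n k x y /KP[m mk /cayley_dist_le wm].
by apply: le_trans wm _; rewrite ler_nat.
Qed.

Lemma cayley_diam_bounded n : exists m : nat, forall x y : coset_type n,
  cayley_dist R S x y <= m%:R.
Proof.
have /fin_all_exists[m mP] : forall xy : coset_type n * coset_type n,
    exists m : nat, cayley_dist R S xy.1 xy.2 = m%:R.
  by move=> xy; have [m _ ->] := cayley_dist_attained xy.1 xy.2; exists m.
exists (\max_xy m xy)%N => x y; rewrite (mP (x, y)) ler_nat.
exact: leq_bigmax.
Qed.

Lemma cayley_dist_diam n (x y : coset_type n) :
  cayley_dist R S x y <= cayley_diam R S (cong n).
Proof.
apply: ub_le_sup; last by exists x, y.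
by have [m mP] := cayley_diam_bounded n; exists m%:R => _ [u [v ->]].
Qed.

Lemma cayley_diam_ge0 n : 0 <= cayley_diam R S (cong n).
Proof.
apply: le_trans (cayley_dist_diam (coset n 1%g) (coset n 1%g)).
exact: cayley_dist_ge0.
Qed.

(** The two points of [coset_far] are at large word distance, hence at large Cayley distance. *)
Lemma cayley_diam_large (k : nat) : exists J, forall n, (J <= n)%N ->
  k%:R < cayley_diam R S (cong n).
Proof.
have [K KP] := dist_word_near.
have [J JP] := modulus_large (2 * 3 ^ (k * K)); exists J.+1 => -[|n] // /JP.
case/coset_far => x [y far]; rewrite ltNge; apply/negP => le_k.
by apply/far/KP; apply: le_trans (cayley_dist_diam x y) le_k.
Qed.

End CayleyGraph.

(** * Coarse equivalences of box spaces *)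

Lemma proper_control_bounded (R : realType) (rho : R -> R) (r : nat) :
  proper_control rho ->
  exists k : nat, forall t, 0 <= t -> rho t <= r%:R -> t <= k%:R.
Proof.
case=> rho_ge0 rho_proper.
have : bounded_set [set t : R | 0 <= t <= r%:R].
  exists r%:R; split; first exact: num_real.
  move=> x rx t /= /andP[t0 tr]; rewrite ger0_norm //.
  exact: le_trans tr (ltW rx).
(* The witness [M] gives a bound only at numbers beyond it, such as [M + 1]. *)
case/rho_proper=> M [_ /(_ (M + 1))]; rewrite ltrDl ltr01 => /(_ isT) bM.
exists (Num.bound `|M + 1|) => t t0 tr.
have /= : `|t| <= M + 1 by apply: bM; split=> //=; rewrite rho_ge0 //= tr.
rewrite (ger0_norm t0) => tM; apply: le_trans tM _.
exact: le_trans (ler_norm _) (ltW (archi_boundP (normr_ge0 _))).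
Qed.

Section BoxDistance.
Variables (R : realType) (S : set sanov).
Hypothesis genS : generates S.
Variable f : nat -> nat.

Definition in_box i (x : coset_type (f i)) : box (fun i => cong (f i)) :=
  existT (fun i => quotient (cong (f i))) i x.

Lemma in_box_surj b : exists x : coset_type (f (tag b)), b = in_box x.
Proof. by case: b => i x; exists x. Qed.

Lemma in_box_tag i b : tag b = i -> exists x : coset_type (f i), b = in_box x.
Proof. by move=> <-; apply: in_box_surj. Qed.

Local Notation dist := (box_dist R S (fun i => cong (f i))).
Local Notation diam i := (cayley_diam R S (cong (f i))).

Lemma in_box_dist i (x y : coset_type (f i)) :
  dist (in_box x) (in_box y) = cayley_dist R S x y.
Proof. by rewrite /box_dist /= eqxx tagged_asE. Qed.

Lemma box_dist_neq b c : tag b != tag c -> dist b c = diam (tag b) + diam (tag c).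
Proof. by rewrite /box_dist; case: eqP. Qed.

Lemma box_dist_ge0 b c : 0 <= dist b c.
Proof.
case: (eqVneq (tag b) (tag c)) => [bc|/box_dist_neq ->]; last first.
  by rewrite addr_ge0 // cayley_diam_ge0.
have [y ->] := in_box_surj c; have [x ->] := in_box_tag bc.
by rewrite in_box_dist cayley_dist_ge0.
Qed.

(** Points of distinct components are at least [diam (tag b)] apart. *)
Lemma same_component b c k :
  dist b c <= k%:R -> k%:R < diam (tag b) -> tag b = tag c.
Proof.
move=> bc kb; apply/eqP; apply: contraT => /box_dist_neq e.
move: bc; rewrite e leNgt (lt_le_trans kb) //.
by rewrite lerDl cayley_diam_ge0.
Qed.

Lemma initial_components_bounded J : exists D : nat, forall b c,
  (tag b < J)%N -> (tag c < J)%N -> dist b c <= D%:R.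
Proof.
have [D DP] := nat_fun_bounded (fun i => diam i) J; exists (D + D)%N.
move=> b [j y] bJ /= jJ; case: (eqVneq (tag b) j) => [bj|bj]; last first.
  by rewrite box_dist_neq // natrD lerD // DP // ltnW.
have [x ->] := in_box_tag bj; rewrite -[existT _ j y]/(in_box y) in_box_dist.
apply: le_trans (cayley_dist_diam R genS _ _) _.
have /= := DP j (ltnW jJ); move/le_trans; apply; rewrite ler_nat; exact: leq_addr.
Qed.

End BoxDistance.

Section CoarseEquivalence.
Variables (R : realType) (S : set sanov).
Hypotheses (finS : finite_set S) (genS : generates S).
Variables f g : nat -> nat.
Hypotheses (f_ge : forall i, (i <= f i)%N) (g_ge : forall j, (j <= g j)%N).

Local Notation dX := (box_dist R S (fun i => cong (f i))).
Local Notation dY := (box_dist R S (fun j => cong (g j))).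
Local Notation diam n := (cayley_diam R S (cong n)).

Lemma coarse_embedding_controls phi : coarse_embedding dX dY phi ->
  (forall k, exists r : nat, forall i (x x' : coset_type (f i)),
    word_near (@coset_act (f i)) k x x' ->
    dY (phi (in_box x)) (phi (in_box x')) <= r%:R) /\
  (forall r : nat, exists k : nat, forall b c,
    dY (phi b) (phi c) <= r%:R -> dX b c <= k%:R).
Proof.
case=> rho_minus [rho_plus [pm pp ctrl]]; split=> [k|r].
  have [K KP] := word_near_dist R genS.
  have [r rP] := nat_fun_bounded (fun m => rho_plus m%:R) (k * K).
  (* [rho_plus] may be unbounded on bounded sets, but distances inside a
     component are integers. *)
  exists r => i x x' /KP; have := (ctrl (in_box x) (in_box x')).2.
  rewrite in_box_dist; have [m _ ->] := cayley_dist_attained R genS x x'.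
  rewrite ler_nat => le_rho /rP; exact: le_trans.
have [k kP] := proper_control_bounded r pm; exists k => b c bc.
apply: kP; first exact: box_dist_ge0.
exact: le_trans (ctrl b c).1 bc.
Qed.

(** Edges have images of bounded length, while large components are far from all others, so the
    image of a large component stays in one component. Density provides an inverse [psi] up to
    bounded error, which returns to the initial component for the same reason. *)
Lemma coarse_equivalence_components phi : coarse_equivalence dX dY phi ->
  exists k, forall J, exists i j, [/\ (J <= i)%N, (J <= j)%N &
    exists (phi' : coset_type (f i) -> coset_type (g j))
           (psi' : coset_type (g j) -> coset_type (f i)),
    [/\ forall x s,
          word_near (@coset_act _) k (phi' x) (phi' (coset_act x (s, false))),
        forall y s,
          word_near (@coset_act _) k (psi' y) (psi' (coset_act y (s, false))),
        forall x, word_near (@coset_act _) k x (psi' (phi' x))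
      & forall y, word_near (@coset_act _) k y (phi' (psi' y))]].
Proof.
case=> /coarse_embedding_controls[up low] [C' _ dense].
pose C := Num.bound `|C'|.
have {}dense y : exists x, dY y (phi x) <= C%:R.
  have [x yx] := dense y; exists x; apply: le_trans yx _.
  exact: le_trans (ler_norm _) (ltW (archi_boundP (normr_ge0 _))).
have [K1 dist_near] := dist_word_near R finS genS.
have [K2 near_dist] := word_near_dist R genS.
have [r1 up1] := up 1%N.
(* For neighbours [y] and [y'], the points [phi (psi y)] and [phi (psi y')] are joined through [y]
   and [y'] by a word of length at most [C * K1 + 1 + C * K1]; the factor [K2] turns length into
   distance. *)
have [k2 low2] := low ((C * K1 + 1 + C * K1) * K2)%N.
have [k3 low3] := low C.
(* One summand for each of the four conclusions, all fixed before [J0]; the factor [K1] turns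
   distances into word lengths. *)
exists (r1 * K1 + k2 * K1 + k3 * K1 + C * K1)%N => J0.
have [J1 J1P] := cayley_diam_large R finS genS (maxn r1 C).
pose J := maxn J0 J1.
have diamY j : (J <= j)%N -> r1%:R < diam (g j) /\ C%:R < diam (g j).
  move=> Jj; have := J1P (g j); rewrite (leq_trans _ (g_ge j)); last first.
    exact: leq_trans (leq_maxr _ _) Jj.
  move=> /(_ isT) lt; split; apply: le_lt_trans lt;
  by rewrite ler_nat ?leq_maxl ?leq_maxr.
have [D DP] := initial_components_bounded R genS g J.
have [k4 low4] := low D.
have [J2 J2P] := cayley_diam_large R finS genS (maxn k2 (maxn k3 k4)).
pose I := maxn J0 J2.
have diamX i : (I <= i)%N ->
    [/\ k2%:R < diam (f i), k3%:R < diam (f i) & k4%:R < diam (f i)].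
  move=> Ii; have := J2P (f i); rewrite (leq_trans _ (f_ge i)); last first.
    exact: leq_trans (leq_maxr _ _) Ii.
  move=> /(_ isT) lt; split; apply: le_lt_trans lt;
  by rewrite ler_nat !leq_max leqnn ?orbT.
(* Two large components cannot both meet the preimage of the first [J]
   components of the target, which is bounded. *)
have [i [Ii tag_phi]] : exists i, (I <= i)%N /\
    forall x : coset_type (f i), (J <= tag (phi (in_box x)))%N.
  apply: contrapT => no_i.
  have bad i : (I <= i)%N -> exists x : coset_type (f i), (tag (phi (in_box x)) < J)%N.
    move=> Ii; apply: contrapT => no_x; apply: no_i; exists i; split=> // x.
    by rewrite leqNgt; apply/negP => lt; apply: no_x; exists x.
  have [x xJ] := bad I (leqnn I); have [x' x'J] := bad I.+1 (leqnSn I).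
  have /low4 le_k4 := DP _ _ xJ x'J.
  have [_ _ k4_lt] := diamX I (leqnn I).
  have e : I = I.+1 by exact: (same_component genS le_k4 k4_lt).
  by move/eqP: e; rewrite ltn_eqF.
have [k2_lt k3_lt _] := diamX i Ii.
pose x0 := coset (f i) 1%g; pose j := tag (phi (in_box x0)).
have Jj : (J <= j)%N by apply: tag_phi.
have [r1_lt C_lt] := diamY j Jj.
have tag_phi_j : forall x : coset_type (f i), tag (phi (in_box x)) = j.
  apply: (word_connected_ind (@coset_connected _) (x0 := x0)) => // x y xy xj.
  rewrite -[RHS]xj; apply/esym/(same_component genS (up1 _ _ _ xy)).
  by rewrite xj.
have /choice[phi' phi'E] : forall x : coset_type (f i), exists y : coset_type (g j),
    phi (in_box x) = in_box y by move=> x; apply: in_box_tag.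
have /choice[psi psiP] : forall y : coset_type (g j), exists b,
    dY (in_box y) (phi b) <= C%:R by move=> y; apply: dense.
(* Being within [C] of [y], the point [phi (psi y)] lies in component [j], whose diameter exceeds
   [C]. *)
have /choice[eta etaE] : forall y, exists z : coset_type (g j), phi (psi y) = in_box z.
  by move=> y; apply: in_box_tag; apply/esym/(same_component genS (psiP y) C_lt).
have near_eta y : word_near (@coset_act _) (C * K1) y (eta y).
  by apply: dist_near; have := psiP y; rewrite etaE in_box_dist.
have psi_step y y' : word_near (@coset_act _) 1 y y' -> dX (psi y) (psi y') <= k2%:R.
  move=> yy'; apply: low2; rewrite !etaE in_box_dist; apply: near_dist.
  apply: word_near_trans (near_eta y'); apply: word_near_trans yy'.
  by apply: word_near_sym (near_eta y); apply: coset_actK.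
have psi_phi x : dX (in_box x) (psi (phi' x)) <= k3%:R.
  by apply: low3; rewrite phi'E.
have tag_psi y : tag (psi y) = i.
  move: y; apply: (word_connected_ind (@coset_connected _) (x0 := phi' x0)).
    exact/esym/(same_component genS (psi_phi x0) k3_lt).
  move=> y y' yy' yi; rewrite -[RHS]yi; apply/esym.
  by apply: (same_component genS (psi_step _ _ yy')); rewrite yi.
have /choice[psi' psi'E] : forall y, exists x : coset_type (f i), psi y = in_box x.
  by move=> y; apply: in_box_tag.
have etaphi y : eta y = phi' (psi' y).
  have := etaE y; rewrite psi'E phi'E => e; apply/esym.
  by have := congr1 (tagged_as (in_box (phi' (psi' y)))) e; rewrite !tagged_asE.
exists i, j; split.
- exact: leq_trans (leq_maxl _ _) Ii.
- exact: leq_trans (leq_maxl _ _) Jj.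
exists phi', psi'; split=> [x s|y s|x|y].
- apply: (@word_near_le _ _ (r1 * K1)); first by lia.
  by apply: dist_near; rewrite -in_box_dist -!phi'E; apply/up1/word_near1.
- apply: (@word_near_le _ _ (k2 * K1)); first by lia.
  by apply: dist_near; rewrite -in_box_dist -!psi'E; apply/psi_step/word_near1.
- apply: (@word_near_le _ _ (k3 * K1)); first by lia.
  by apply: dist_near; rewrite -in_box_dist -psi'E.
- apply: (@word_near_le _ _ (C * K1)); first by lia.
  by rewrite -etaphi.
Qed.

(** As [k] does not depend on [J], matched components can be taken with girth large compared with
    [k]. Their orders are then equal, and the order determines the level. *)
Lemma coarsely_equivalent_common_index :
  coarsely_equivalent dX dY -> exists i j, f i = g j.
Proof.
case=> phi /coarse_equivalence_components[k kP].
have [J JP] := modulus_large (2 * 3 ^ (k + k * k + k.+1)).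
have [i [j [Ji Jj [phi' [psi' [h1 h2 h3 h4]]]]]] := kP J.
exists i, j; apply: card_coset_type_inj; apply/eqP; rewrite eqn_leq.
have freeX := @coset_locally_free (f i) rat^o _ (JP _ (leq_trans Ji (f_ge i))).
have freeY := @coset_locally_free (g j) rat^o _ (JP _ (leq_trans Jj (g_ge j))).
have cX := @coset_connected (f i); have cY := @coset_connected (g j).
have aX := @coset_actK (f i); have aY := @coset_actK (g j).
apply/andP; split.
  exact: (leq_card_of_coarse_inverse aX aY (coset _ 1%g) cX cY freeX h1 h2 h3).
exact: (leq_card_of_coarse_inverse aY aX (coset _ 1%g) cY cX freeY h2 h1 h4).
Qed.

End CoarseEquivalence.

Theorem theorem1p7 (R : realType) :
  exists (G : groupType) (N M : nat -> set G),
    [/\ finitely_generated G, residually_finite G,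
        is_filtration N & is_filtration M]
    /\ (forall i, N i `<=` M i)
    /\ (exists K : nat, forall i, index_le (M i) (N i) K)
    /\ forall S : set G, finite_set S -> generates S ->
         ~ coarsely_equivalent (box_dist R S N) (box_dist R S M).
Proof.
exists sanov, (fun i => cong (2 * i).+1%N), (fun i => cong (2 * i)%N).
split; first split.
- exact: sanov_finitely_generated.
- exact: sanov_residually_finite.
- by apply: (@cong_filtration (fun i => (2 * i).+1%N)) => i /=; lia.
- by apply: (@cong_filtration (fun i => (2 * i)%N)) => i /=; lia.
split; first by move=> i; apply: cong_decr.
split; first by eexists => i; apply: cong_index.
move=> S finS genS /(coarsely_equivalent_common_index finS genS).
(* The indices [(2 * i).+1] and [2 * j] have different parities. *)
by case=> [i|j|i [j]]; lia.
Qed.
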